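(* Let $k\ge1$ be an integer, let $\underline y=(y_e)$ be positive edge weights and let $\underline x=\underline y^{-1}$, i.e. $x_e=y_e^{-1}$. Let $\mathsf q=(q_1,\dots,q_k)$ be a collection of $k$ elements of $\operatorname{im} d^*$ (functions $q_i:V\to\mathbb K$ with $\sum_vq_i(v)=0$). Then $$\frac{\Psi_{k+1,\mathsf q}(\underline y)}{\Psi_1(\underline y)}=\big\langle q_1\wedge\dots\wedge q_k,\ (G_{\underline x})^{\wedge k}(q_1\wedge\dots\wedge q_k)\big\rangle=\det\Big[\big(\langle q_i,G_{\underline x}q_j\rangle\big)_{1\le i,j\le k}\Big],$$ where $$\Psi_1(\underline y)=\sum_{T\in\mathcal T(G)}\underline y^{E\setminus T},\qquad \Psi_{k+1,\mathsf q}(\underline y)=\sum_{F\in\mathcal F_k(G)}\big|\det\big(q_i(V(T_j))\big)_{1\le i,j\le k}\big|^2\,\underline y^{E\setminus F}.$$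
   Context: Let $\mathbb K=\mathbb R$ or $\mathbb C$. $G=(V,E)$ is a finite connected graph: $V$ is a finite set of vertices and $E$ a finite set of oriented edges, with source and target maps $s,t:E\to V$ and a fixed-point-free involution $e\mapsto e^{-1}$ of $E$ exchanging source and target. $E^+\subset E$ is a fixed subset containing exactly one element of each pair $\{e,e^{-1}\}$. Edge weights satisfy $x_{e^{-1}}=x_e$, and $\underline x^A=\prod_{e\in (A\cup A^{-1})\cap E^+}x_e$ for $A\subseteq E$. A subgraph is a subset $S\subseteq E$ stable under $e\mapsto e^{-1}$, seen as the graph $(V,S)$. $\mathcal T(G)$ is the set of spanning trees; $\mathcal F_k(G)$ is the set of acyclic (spanning) subgraphs with $k+1$ connected components (trees). For $F\in\mathcal F_k(G)$, $T_1,\dots,T_k$ is an enumeration of all the trees of $F$ except one, $V(T_j)$ is the vertex set of $T_j$, and $q_i(V(T_j))=\sum_{v\in V(T_j)}q_i(v)$ (the squared modulus of the determinant does not depend on the choices). $\Omega^0(G)$ is the space of functions $V\to\mathbb K$ with $\langle f,g\rangle=\sum_v\overline{f(v)}g(v)$; $\Omega^1(G)$ is the space of functions $\alpha:E\to\mathbb K$ with $\alpha(e^{-1})=-\alpha(e)$, with $\langle\alpha,\beta\rangle=\sum_{e\in E^+}x_e\overline{\alpha(e)}\beta(e)$. $df(e)=f(t(e))-f(s(e))$, $d^*$ is the adjoint of $d$, $\Delta=d^*d$. The space $\operatorname{im} d^*=(\ker d)^\perp$ is the space of functions with zero sum; $\Delta$ restricts to an invertible operator of $\operatorname{im} d^*$,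 whose inverse is the Green function $G_{\underline x}$ (an operator acting on $\operatorname{im} d^*$). Exterior powers carry the inner product $\langle u_1\wedge\dots\wedge u_k,v_1\wedge\dots\wedge v_k\rangle=\det(\langle u_i,v_j\rangle)$, and $a^{\wedge k}$ is the map induced by $a$ on $k$-th exterior powers. *)

(* Defs.v *)
From HB Require Import structures.
From mathcomp Require Import all_boot all_order all_algebra.
From mathcomp Require Import boolp reals ring.
From mathcomp.real_closed Require Import complex.
From mathcomp.multinomials Require Import freeg.

Set Implicit Arguments.
Unset Strict Implicit.
Unset Printing Implicit Defensive.

Import Order.TTheory GRing.Theory Num.Theory.
Local Open Scope ring_scope.
Local Open Scope quotient_scope.

Variant scalar_kind := RealScalars | ComplexScalars.

(* In R[i] the order is 0 < z iff z is real and positive, so that "0 < y e"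
   means that y e is a positive real number for both kinds of scalars. *)
Definition scalar_field (R : realType) (c : scalar_kind) : numFieldType :=
  match c with RealScalars => R | ComplexScalars => R[i] end.

Definition sconj (R : realType) (c : scalar_kind) :
    {rmorphism scalar_field R c -> scalar_field R c} :=
  match c with
  | RealScalars => idfun
  | ComplexScalars => @conjc R
  end.

Section ExteriorPower.
Variables (K : fieldType) (U : lmodType K) (k : nat).
Implicit Types u v : {ffun 'I_k -> U}.

Definition upd u (i : 'I_k) (x : U) : {ffun 'I_k -> U} :=
  [ffun j => if j == i then x else u j].

Local Notation formal := {freeg {ffun 'I_k -> U} / K}.

Variant ext_relator : formal -> Prop :=
| ExtLin u i (a : K) (x y : U) :
    ext_relator (<< 1 *g upd u i (a *: x + y) >>
                 - (a *: << 1 *g upd u i x >> + << 1 *g upd u i y >>))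
| ExtAlt u i j of i != j & u i = u j : ext_relator << 1 *g u >>.

Inductive ext_null : formal -> Prop :=
| ExtNull0 : ext_null 0
| ExtNullD a r s of ext_relator r & ext_null s : ext_null (a *: r + s).

Lemma ext_null_lin a r s : ext_null r -> ext_null s -> ext_null (a *: r + s).
Proof.
elim=> [|b r' s' Hr Hs IH] H; first by rewrite scaler0 add0r.
by rewrite scalerDr scalerA -addrA; constructor=> //; apply: IH.
Qed.

Definition ext_nullb : {pred formal} := fun r => `[< ext_null r >].

Fact ext_nullb_zmod : zmod_closed ext_nullb.
Proof.
split=> [|r s]; rewrite !unfold_in; first by apply/asboolP; constructor.
move=> /asboolP Hr /asboolP Hs; apply/asboolP.
by rewrite addrC -scaleN1r; apply: ext_null_lin.
Qed.

HB.instance Definition _ := GRing.isZmodClosed.Build formal ext_nullb ext_nullb_zmod.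

(* The quotient of the vector space freely generated by U^k by the relations
   of multilinearity and alternation. *)
Definition extpow := Quotient.quot ext_nullb.
HB.instance Definition _ := GRing.Zmodule.on extpow.

Definition pi_ext (r : formal) : extpow := \pi_(extpow) r.

Definition ext_scale (a : K) (w : extpow) : extpow := pi_ext (a *: repr w).

Lemma pi_extP (r s : formal) : reflect (pi_ext r = pi_ext s) (ext_nullb (r - s)).
Proof.
rewrite -[ext_nullb _]/(r - s \in (ext_nullb : pred _)).
by rewrite Quotient.idealrBE; exact: eqP.
Qed.

Let pi_extD (r s : formal) : pi_ext (r + s) = pi_ext r + pi_ext s.
Proof. by rewrite /pi_ext !piE. Qed.

Lemma pi_extZ a (r : formal) : pi_ext (a *: r) = ext_scale a (pi_ext r).
Proof.
apply/pi_extP; rewrite -scalerBr; apply/asboolP; rewrite -[_ *: _]addr0.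
apply: ext_null_lin; last by constructor.
by apply/asboolP/pi_extP; rewrite /pi_ext reprK.
Qed.

Let extW (w : extpow) : pi_ext (repr w) = w.
Proof. exact: reprK. Qed.

Fact ext_scaleA a b w : ext_scale a (ext_scale b w) = ext_scale (a * b) w.
Proof. by rewrite -(extW w) -!pi_extZ scalerA. Qed.

Fact ext_scale1 : left_id 1 ext_scale.
Proof. by move=> w; rewrite -(extW w) -!pi_extZ scale1r. Qed.

Fact ext_scaleDr : right_distributive ext_scale +%R.
Proof.
move=> a w z; rewrite -(extW w) -(extW z) -!(pi_extD, pi_extZ).
by rewrite scalerDr pi_extD.
Qed.

Fact ext_scaleDl w : {morph ext_scale^~ w : a b / a + b}.
Proof. by move=> a b; rewrite -(extW w) -!pi_extZ scalerDl pi_extD. Qed.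

HB.instance Definition _ := GRing.Zmodule_isLmodule.Build K extpow
  ext_scaleA ext_scale1 ext_scaleDr ext_scaleDl.

Definition wedge u : extpow := pi_ext << 1 *g u >>.

Definition multilinear (W : lmodType K) (f : {ffun 'I_k -> U} -> W) :=
  forall u i a x y, f (upd u i (a *: x + y)) = a *: f (upd u i x) + f (upd u i y).

Definition alternating (W : lmodType K) (f : {ffun 'I_k -> U} -> W) :=
  forall u i j, i != j -> u i = u j -> f u = 0.

Lemma wedge_multilinear : multilinear wedge.
Proof.
move=> u i a x y; rewrite -[a *: wedge _]pi_extZ -pi_extD; apply/pi_extP.
apply/asboolP; rewrite -[X in ext_null X]addr0 -[X in X + 0]scale1r.
by constructor; constructor.
Qed.

Lemma wedge_alternating : alternating wedge.
Proof.
move=> u i j ne_ij eq_u.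
have <- : pi_ext 0 = 0 by apply: (@addIr _ (pi_ext 0)); rewrite -pi_extD !add0r.
apply/pi_extP; rewrite subr0; apply/asboolP; rewrite -[X in ext_null X]addr0.
rewrite -[X in X + 0]scale1r; constructor; last by constructor.
exact: ExtAlt ne_ij eq_u.
Qed.

(* On a map f which is not multilinear and alternating, ext_lift is junk. *)
Definition ext_lift (W : lmodType K) (f : {ffun 'I_k -> U} -> W) (w : extpow) : W :=
  fglift f (repr w).

Lemma ext_liftE (W : lmodType K) (f : {ffun 'I_k -> U} -> W) w :
  ext_lift f w = \sum_(u <- dom (repr w)) coeff u (repr w) *: f u.
Proof.
by rewrite /ext_lift -{1}[repr w]Freeg_dom fglift_Freeg /prelift big_map.
Qed.

Section Lift.
Variables (W : lmodType K) (f : {ffun 'I_k -> U} -> W).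
Hypotheses (f_lin : multilinear f) (f_alt : alternating f).

Lemma fglift_lin a (r s : formal) : fglift f (a *: r + s) = a *: fglift f r + fglift f s.
Proof.
pose h : {additive formal -> W} := HB.pack (fglift f)
  (GRing.isZmodMorphism.Build _ _ (fglift f) (@lift_is_additive _ _ _ f)).
have hZ b (t : formal) : h (b *: t) = b *: h t.
  rewrite -[t]freeg_sumE scaler_sumr !raddf_sum /=.
  apply: eq_bigr => u _; rewrite (_ : b *: _ = << b * coeff u t *g u >>).
    by rewrite /h /= !liftU scalerA.
  by apply/eqP/freeg_eqP => v; rewrite coeffZ !coeffU mulrA.
by rewrite -[fglift f]/(h : formal -> W) raddfD hZ.
Qed.

Lemma ext_lift_pi (r : formal) : ext_lift f (pi_ext r) = fglift f r.
Proof.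
have fD a r1 s1 := fglift_lin a r1 s1.
have f0 : fglift f 0 = 0.
  by have := fD 1 0 0; rewrite !scale1r addr0 => /(congr1 (+%R^~ (- fglift f 0))); rewrite addrK subrr.
have fU u : fglift f << 1 *g u >> = f u by rewrite liftU scale1r.
have E : fglift f (repr (pi_ext r) - r) = 0.
  have /asboolP: ext_nullb (repr (pi_ext r) - r) by apply/pi_extP; rewrite extW.
  elim=> // a _ s [u i b x y|u i j ne_ij eq_u] _ IH; rewrite fD IH addr0.
    rewrite addrC -scaleN1r fD fD !fU f_lin // scaleN1r addNr scaler0 //.
  by rewrite fU (f_alt ne_ij eq_u) scaler0.
by apply/eqP; rewrite -subr_eq0 -scaleN1r addrC -fD scaleN1r addrC E.
Qed.

Lemma ext_lift_wedge u : ext_lift f (wedge u) = f u.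
Proof. by rewrite ext_lift_pi liftU scale1r. Qed.

Lemma ext_lift_linear : linear (ext_lift f).
Proof.
move=> a w z; rewrite -(extW w) -(extW z).
have -> : a *: pi_ext (repr w) + pi_ext (repr z) = pi_ext (a *: repr w + repr z).
  by rewrite pi_extD pi_extZ.
by rewrite !ext_lift_pi fglift_lin.
Qed.
End Lift.
End ExteriorPower.

Section ExtMap.
Variables (K : fieldType) (U W : lmodType K) (k : nat).

Definition ext_map (a : U -> W) : extpow U k -> extpow W k :=
  ext_lift (fun u => wedge [ffun i => a (u i)]).

Variable (a : {linear U -> W}).

Let map_upd (u : {ffun 'I_k -> U}) i x :
  [ffun j => a (upd u i x j)] = upd [ffun j => a (u j)] i (a x).
Proof. by apply/ffunP => j; rewrite !ffunE; case: (j == i). Qed.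

Let map_lin : multilinear (fun u : {ffun 'I_k -> U} => wedge [ffun i => a (u i)]).
Proof. by move=> u i b x y; rewrite !map_upd linearP wedge_multilinear. Qed.

Let map_alt : alternating (fun u : {ffun 'I_k -> U} => wedge [ffun i => a (u i)]).
Proof.
move=> u i j ne_ij eq_u; apply: (wedge_alternating ne_ij).
by rewrite !ffunE eq_u.
Qed.

Lemma ext_map_wedge (u : {ffun 'I_k -> U}) :
  ext_map a (wedge u) = wedge [ffun i => a (u i)].
Proof. exact: (ext_lift_wedge map_lin map_alt). Qed.

Lemma ext_map_linear : linear (ext_map a).
Proof. exact: (ext_lift_linear map_lin map_alt). Qed.
End ExtMap.

Section ExtDot.
Variables (K : fieldType) (U : lmodType K) (k : nat).
Variables (conj : {rmorphism K -> K}) (B : U -> U -> K).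

Definition gram (u v : {ffun 'I_k -> U}) : K^o := \det (\matrix_(i, j) B (u i) (v j)).

(* The extension of (u_1 ^ .. ^ u_k, v_1 ^ .. ^ v_k) |-> det (B u_i v_j) which
   is conj-linear in w and linear in z. *)
Definition ext_dot (w z : extpow U k) : K :=
  conj (ext_lift (fun u => conj (ext_lift (gram u) z) : K^o) w).

Hypothesis conjK : involutive conj.
Hypothesis BDl : forall a x y z, B (a *: x + y) z = conj a * B x z + B y z.
Hypothesis BDr : forall a x y z, B z (a *: x + y) = a * B z x + B z y.

Let conj_lin (a p q r : K) : p = conj a * q + r -> conj p = a * conj q + conj r.
Proof. by move=> ->; rewrite rmorphD rmorphM conjK. Qed.

Let gramDr u : multilinear (gram u).
Proof.
move=> v i a x y; rewrite -[gram u (upd v i x)]mul1r.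
rewrite /gram -!(det_tr (\matrix_(_, _) _)).
rewrite mul1r -[X in _ = _ + X]mul1r; apply: (determinant_multilinear (i0 := i)).
- by apply/rowP => j; rewrite !mxE !ffunE eqxx BDr mul1r.
- by apply/matrixP => p q; rewrite !mxE !ffunE eq_sym (negPf (neq_lift _ _)).
- by apply/matrixP => p q; rewrite !mxE !ffunE eq_sym (negPf (neq_lift _ _)).
Qed.

Let gram_altr u : alternating (gram u).
Proof.
move=> v i j ne_ij eq_v; rewrite /gram -det_tr.
by apply: (determinant_alternate ne_ij) => p; rewrite !mxE eq_v.
Qed.

Let gramDl v u i a x y :
  gram (upd u i (a *: x + y)) v = conj a * gram (upd u i x) v + gram (upd u i y) v.
Proof.
rewrite -[X in _ = _ + X]mul1r; apply: (determinant_multilinear (i0 := i)).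
- by apply/rowP => j; rewrite !mxE !ffunE eqxx BDl mul1r.
- by apply/matrixP => p q; rewrite !mxE !ffunE eq_sym (negPf (neq_lift _ _)).
- by apply/matrixP => p q; rewrite !mxE !ffunE eq_sym (negPf (neq_lift _ _)).
Qed.

Let dotl z (u : {ffun 'I_k -> U}) : K^o := conj (ext_lift (gram u) z).

Let dotl_lin z : multilinear (dotl z).
Proof.
move=> u i a x y; rewrite /dotl !ext_liftE; apply: conj_lin; rewrite mulr_sumr -big_split /=; apply: eq_bigr => v _.
rewrite gramDl /GRing.scale /=; ring.
Qed.

Let dotl_alt z : alternating (dotl z).
Proof.
move=> u i j ne_ij eq_u; rewrite /dotl ext_liftE big1 ?rmorph0 // => v _.
rewrite /gram (determinant_alternate ne_ij) ?scaler0 // => p.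
by rewrite !mxE eq_u.
Qed.

Lemma ext_dot_wedge (u v : {ffun 'I_k -> U}) :
  ext_dot (wedge u) (wedge v) = \det (\matrix_(i, j) B (u i) (v j)).
Proof.
rewrite /ext_dot (ext_lift_wedge (@dotl_lin _) (@dotl_alt _)) /dotl conjK.
by rewrite (ext_lift_wedge (@gramDr _) (@gram_altr _)).
Qed.

Lemma ext_dotDl a w1 w2 z :
  ext_dot (a *: w1 + w2) z = conj a * ext_dot w1 z + ext_dot w2 z.
Proof.
by rewrite /ext_dot (ext_lift_linear (@dotl_lin _) (@dotl_alt _)) rmorphD rmorphM.
Qed.

Lemma ext_dotDr a w z1 z2 :
  ext_dot w (a *: z1 + z2) = a * ext_dot w z1 + ext_dot w z2.
Proof.
rewrite /ext_dot !ext_liftE; apply: conj_lin; rewrite mulr_sumr -big_split /=; apply: eq_bigr => u _.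
rewrite (ext_lift_linear (@gramDr _) (@gram_altr _)) rmorphD rmorphM /GRing.scale /=.
ring.
Qed.
End ExtDot.

Record graph := Graph {
  vertex : finType;
  edge : finType;
  src : edge -> vertex;
  tgt : edge -> vertex;
  einv : edge -> edge;
  epos : {set edge};
  einvK : involutive einv;
  einv_neq : forall e, einv e != e;
  src_einv : forall e, src (einv e) = tgt e;
  tgt_einv : forall e, tgt (einv e) = src e;
  epos_einv : forall e, (einv e \in epos) = (e \notin epos)
}.

Section Subgraphs.
Variable G : graph.
Implicit Types S : {set edge G}.

Definition subgraph S : Prop := forall e, e \in S -> einv e \in S.

Definition adj S : rel (vertex G) :=
  fun u v => [exists e in S, (src e == u) && (tgt e == v)].

Definition connected S : Prop :=
  (0 < #|vertex G|)%N /\ forall u v, connect (adj S) u v.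

(* A cycle has no repeated vertex and does not backtrack: loops and pairs of
   parallel edges are cycles, whereas [:: e; einv e] is not. *)
Definition simple_cycle S (c : seq (edge G)) : bool :=
  [&& c != [::], all [in S] c, uniq [seq src e | e <- c]
    & cycle (fun e f => (tgt e == src f) && (f != einv e)) c].

Definition acyclic S : Prop := forall c, ~~ simple_cycle S c.

Definition components S : {set {set vertex G}} :=
  [set [set v | connect (adj S) u v] | u : vertex G].

Definition spanning_trees : {set {set edge G}} :=
  [set S | `[< [/\ subgraph S, connected S & acyclic S] >]].

Definition forests (k : nat) : {set {set edge G}} :=
  [set S | `[< [/\ subgraph S, acyclic S & #|components S| = k.+1] >]].

(* An enumeration of all the components but one of each F in F_k(G). *)
Definition tree_enumeration k (T : {set edge G} -> 'I_k -> {set vertex G}) : Prop :=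
  forall F, F \in forests k ->
    injective (T F) /\ forall j, T F j \in components F.
End Subgraphs.

Arguments spanning_trees : clear implicits.
Arguments forests : clear implicits.

Section Forms.
Variables (K : numFieldType) (conj : {rmorphism K -> K}) (G : graph).

Local Notation Omega0 := {ffun vertex G -> K^o}.

Definition sym_part (alpha : {ffun edge G -> K^o}) : {ffun edge G -> K^o} :=
  [ffun e => alpha (einv e) + alpha e].

Fact sym_part_linear : linear sym_part.
Proof. by move=> a f g; apply/ffunP => e; rewrite !ffunE scalerDr addrACA. Qed.

HB.instance Definition _ := GRing.isLinear.Build K
  {ffun edge G -> K^o} {ffun edge G -> K^o} _ sym_part sym_part_linear.

Definition antisym : {vspace {ffun edge G -> K^o}} := lker (linfun sym_part).

Lemma antisymP (alpha : {ffun edge G -> K^o}) :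
  reflect (forall e, alpha (einv e) = - alpha e) (alpha \in antisym).
Proof.
rewrite memv_ker lfunE /=; apply: (iffP eqP) => [/ffunP H e | H].
  by apply/eqP; rewrite -addr_eq0; have := H e; rewrite !ffunE => ->.
by apply/ffunP => e; rewrite !ffunE H addNr.
Qed.

Local Notation Omega1 := (subvs_of antisym).

Definition dot0 (f g : Omega0) : K := \sum_v conj (f v) * g v.

Definition dot1 (x : edge G -> K) (alpha beta : Omega1) : K :=
  \sum_(e in epos G) x e * conj (vsval alpha e) * vsval beta e.

Definition grad (f : Omega0) : {ffun edge G -> K^o} :=
  [ffun e => f (tgt e) - f (src e)].

Lemma grad_antisym f : grad f \in antisym.
Proof. by apply/antisymP => e; rewrite !ffunE src_einv tgt_einv opprB. Qed.

Definition grad1 (f : Omega0) : Omega1 := Subvs (grad_antisym f).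

Fact grad1_linear : linear grad1.
Proof.
move=> a f g; apply: val_inj; apply/ffunP => e; rewrite linearP !ffunE /=.
by rewrite scalerBr opprD addrACA.
Qed.

HB.instance Definition _ := GRing.isLinear.Build K Omega0 Omega1 _ grad1 grad1_linear.

Definition differential : 'Hom(Omega0, Omega1) := linfun grad1.

Lemma differentialE f e : vsval (differential f) e = f (tgt e) - f (src e).
Proof. by rewrite lfunE /= ffunE. Qed.

Definition delta (v : vertex G) : Omega0 := [ffun w => (w == v)%:R].

Section Weighted.
Variable x : edge G -> K.

(* The delta functions being orthonormal in Omega0, the adjoint of d is forced
   to be (d^* alpha)(v) = <delta_v, d^* alpha> = <d delta_v, alpha>; see dstar_adjoint. *)
Definition codiff (alpha : Omega1) : Omega0 := [ffun v => dot1 x (differential (delta v)) alpha].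

Fact codiff_linear : linear codiff.
Proof.
move=> a f g; apply/ffunP => v; rewrite !ffunE /dot1 scaler_sumr -big_split /=.
by apply: eq_bigr => e _; rewrite !ffunE /GRing.scale /=; ring.
Qed.

HB.instance Definition _ := GRing.isLinear.Build K Omega1 Omega0 _ codiff codiff_linear.

Definition dstar : 'Hom(Omega1, Omega0) := linfun codiff.

Lemma dstar_adjoint f alpha : dot0 f (dstar alpha) = dot1 x (differential f) alpha.
Proof.
rewrite /dot0 /dot1 lfunE /=.
under eq_bigr do rewrite ffunE mulr_sumr.
rewrite exchange_big /=; apply: eq_bigr => e _.
under eq_bigr do rewrite mulrA.
rewrite -mulr_suml; congr (_ * _).
under eq_bigr do rewrite mulrCA -rmorphM.
rewrite -mulr_sumr -rmorph_sum; congr (_ * conj _).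
have sum_delta w : \sum_v (f v : K) * (w == v)%:R = f w.
  rewrite (bigD1 w) //= eqxx mulr1 big1 ?addr0 // => v.
  by rewrite eq_sym => /negPf->; rewrite mulr0.
rewrite differentialE -!sum_delta -sumrB; apply: eq_bigr => v _.
by rewrite differentialE !ffunE -mulrBr.
Qed.

Definition laplacian : 'End(Omega0) := (dstar \o differential)%VF.

Definition im_dstar : {vspace Omega0} := limg dstar.

Lemma laplacian_im f : laplacian f \in im_dstar.
Proof. by rewrite comp_lfunE memv_img ?memvf. Qed.

Definition lap_res (u : subvs_of im_dstar) : subvs_of im_dstar :=
  Subvs (laplacian_im (vsval u)).

Fact lap_res_linear : linear lap_res.
Proof. by move=> a u v; apply: val_inj; rewrite /= !linearP. Qed.

HB.instance Definition _ := GRing.isLinear.Build K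
  (subvs_of im_dstar) (subvs_of im_dstar) _ lap_res lap_res_linear.

(* For positive weights lap_res is bijective, and ^-1 is then its inverse. *)
Definition green : 'End(subvs_of im_dstar) := ((linfun lap_res)^-1)%VF.

Definition dot_im (u v : subvs_of im_dstar) : K := dot0 (vsval u) (vsval v).

(* x^A, the product having one factor for each pair {e, e^-1} which meets A. *)
Definition monomial (A : {set edge G}) : K :=
  \prod_(e in (A :|: [set einv e | e in A]) :&: epos G) x e.

Definition psi1 : K := \sum_(T in spanning_trees G) monomial (~: T).

Definition psi k (T : {set edge G} -> 'I_k -> {set vertex G}) (q : 'I_k -> Omega0) : K :=
  \sum_(F in forests G k)
    `|\det (\matrix_(i < k, j < k) \sum_(v in T F j) (q i v : K))| ^+ 2
      * monomial (~: F).
End Weighted.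
End Forms.

Arguments dot_im {K} conj {G} x u v.

(* Main.v *)
Require Import Defs.
From mathcomp Require Import all_boot all_order all_algebra perm.
From mathcomp Require Import boolp reals ring.
From mathcomp.real_closed Require Import complex.

Set Implicit Arguments.
Unset Strict Implicit.
Unset Printing Implicit Defensive.

Import Order.TTheory GRing.Theory Num.Theory.
Local Open Scope ring_scope.

(** Let [L] be the matrix of the Laplacian, [Q] the matrix with columns [q_j],
    [A = [1 | Q]], and border [L] into [N_Q = [[L, A], [- A^*, 0]]].

    On the one hand, subtracting from the [Q]-columns the combination of the
    [L]-columns given by [G Q] yields [det N_Q = det N * det (Q^* G Q)], where
    [N] is the case [k = 0].

    On the other hand, for a forest [F] let [P_F] be the 0/1 matrix which sums
    over the components of [F].  As [P_F] maps the incidence vector [d_e] to a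
    difference of two basis vectors, or to [0] if [e] closes a cycle,
      det (P_F (M + x_e d_e d_e^T) P_F^T)
        = det (P_F M P_F^T) + [F + e acyclic] x_e det (P_(F + e) M P_(F + e)^T).
    Processing the edges one by one expands [det N_Q] into the sum over forests
    [F] of [x^F det [[0, P_F A], [- (P_F A)^*, 0]]]; the summand vanishes unless
    [P_F A] is square, that is, unless [F] has [k + 1] components, and is
    [x^F |det (P_F A)|^2] otherwise.  The rows of [P_F A] add up to
    [(#|V|, 0, .., 0)], so [det (P_F A) = #|V| det (q_i(V(T_j)))] up to sign. *)

(** * Determinants *)

Section Determinants.
Variable K : fieldType.

(** By linearity in row [b], the coefficient of [x] is the determinant of [N] with row [b] replaced
    by the [b]-th basis vector, that is, the cofactor. *)
Lemma det_add_delta_diag n (N : 'M[K]_n) b x :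
  \det (N + x *: delta_mx b b) = \det N + x * cofactor N b b.
Proof.
pose C : 'M[K]_n := \matrix_(i, j) if i == b then (j == b)%:R else N i j.
have -> : cofactor N b b = \det C.
  rewrite (expand_det_row _ b) (bigD1 b) //= big1 => [|j /negPf jb].
    rewrite addr0 mxE !eqxx mul1r /cofactor; congr (_ * \det _).
    by apply/matrixP => i j; rewrite !mxE eq_sym (negPf (neq_lift _ _)).
  by rewrite mxE eqxx jb mul0r.
rewrite -[\det N]mul1r; apply: (determinant_multilinear (i0 := b)).
- by apply/rowP => j; rewrite !mxE eqxx /= mul1r.
- apply/matrixP => i j; rewrite !mxE [_ == b]eq_sym (negPf (neq_lift _ _)) /=.
  by rewrite mulr0 addr0.
- apply/matrixP => i j; rewrite !mxE [_ == b]eq_sym (negPf (neq_lift _ _)) /=.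
  by rewrite mulr0 addr0.
Qed.

Lemma det_transvection n (a b : 'I_n) :
  a != b -> \det (1%:M + delta_mx a b : 'M[K]_n) = 1.
Proof.
move=> ab; pose C : 'M[K]_n := \matrix_(i, j) (if i == a then b == j else i == j)%:R.
have C0 : \det C = 0.
  apply: (determinant_alternate ab) => j.
  by rewrite !mxE eqxx [b == a]eq_sym (negPf ab).
rewrite (@determinant_multilinear _ _ _ 1%:M C a 1 1) ?det1 ?C0 ?mulr0 ?addr0 ?mulr1 //.
- by apply/rowP => j; rewrite !mxE eqxx /= !mul1r [b == j]eq_sym.
- by apply/matrixP => i j; rewrite !mxE [_ == a]eq_sym (negPf (neq_lift _ _)) addr0.
- by apply/matrixP => i j; rewrite !mxE [_ == a]eq_sym (negPf (neq_lift _ _)) addr0.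
Qed.

(** Left multiplication adds row [b] to row [a], then deletes row [b]: on labels, [b] is identified
    with [a]. *)
Definition merge_mx n (a b : 'I_n.+1) : 'M[K]_(n, n.+1) :=
  row' b (1%:M + delta_mx a b).

(** The congruence by [U] sends [u] to the basis vector at [b], so only the entry [(b, b)] is
    perturbed; its cofactor is the determinant of [U *m N *m U^T] without row and column [b]. *)
Lemma det_rank1_update n (N : 'M[K]_n.+1) (a b : 'I_n.+1) x (u : 'cV[K]_n.+1) :
    a != b -> u = delta_mx b 0 - delta_mx a 0 ->
  \det (N + x *: (u *m u^T))
    = \det N + x * \det (merge_mx a b *m N *m (merge_mx a b)^T).
Proof.
move=> ab ->; pose U : 'M[K]_n.+1 := 1%:M + delta_mx a b.
have detU M : \det (U *m M *m U^T) = \det M.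
  by rewrite !det_mulmx det_tr det_transvection // mul1r mulr1.
set d := _ - _; have Ud : U *m d = delta_mx b 0.
  rewrite /U mulmxDl mul1mx mulmxBr mul_delta_mx mul_delta_mx_0 1?eq_sym //.
  by rewrite subr0 subrK.
have -> : \det (N + x *: (d *m d^T))
    = \det (U *m N *m U^T + x *: ((U *m d) *m (U *m d)^T)).
  by rewrite -detU mulmxDr mulmxDl -scalemxAr -scalemxAl trmx_mul !mulmxA.
rewrite Ud trmx_delta mul_delta_mx det_add_delta_diag detU; congr (_ + _ * _).
rewrite /cofactor -signr_odd oddD addbb expr0 mul1r; congr (\det _).
rewrite /merge_mx -/U; apply/matrixP => i j; rewrite !mxE.
apply: eq_bigr => l _; rewrite !mxE; congr (_ * _).
by apply: eq_bigr => p _; rewrite !mxE.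
Qed.

(** The three unipotent factors multiply to [[[0, 1], [-1, 0]]]. The minus sign before [B] is what
    avoids a sign depending on [m]. *)
Lemma det_antidiag_block m (A B : 'M[K]_m) :
  \det (block_mx 0 A (- B) 0) = \det A * \det B.
Proof.
have -> : block_mx 0 A (- B) 0 = block_mx A 0 0 B *m (block_mx 1%:M 1%:M 0 1%:M
    *m block_mx 1%:M 0 (- 1%:M) 1%:M *m block_mx 1%:M 1%:M 0 1%:M).
  rewrite !mulmx_block !(mul0mx, mulmx0, mul1mx, mulmx1, mulmxN, addr0, add0r).
  by rewrite addrN !(mulmx1, addNr, mulmx0, addr0, add0r).
by rewrite !det_mulmx !det_ublock !det_lblock !det1 !mulr1.
Qed.

(** In an invertible matrix the first [c] rows [[0 | A]] would have rank [c], but their rank is at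
    most [m]; the last [m] rows give the reverse inequality. *)
Lemma det_antidiag_block0 c m (A : 'M[K]_(c, m)) (B : 'M[K]_(m, c)) :
  c != m -> \det (block_mx 0 A B 0) = 0.
Proof.
move=> cm; apply/eqP/negPn/negP; rewrite -unitfE -unitmxE -row_free_unit => free.
suff : (c <= m)%N && (m <= c)%N by rewrite -eqn_leq (negPf cm).
have rk1 p q (E : 'M[K]_(p, q)) F : E *m F = 1%:M -> \rank E = p.
  by move=> EF; apply/eqP/row_freeP; exists F.
apply/andP; split.
  have := mxrankMfree (row_mx 1%:M 0 : 'M_(c, c + m)) free.
  rewrite mul_row_block !mul1mx !mul0mx !addr0.
  rewrite (rk1 _ _ (row_mx 1%:M 0) (col_mx 1%:M 0));
    last by rewrite mul_row_col !mulmx1 mulmx0 addr0.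
  move=> <-.
  by rewrite -[X in row_mx X _](mulmx0 _ A) -[X in row_mx _ X](mulmx1 A) -mul_mx_row
    mulmx_max_rank.
have := mxrankMfree (row_mx 0 1%:M : 'M_(m, c + m)) free.
rewrite mul_row_block !mul1mx !mul0mx !add0r.
rewrite (rk1 _ _ (row_mx 0 1%:M) (col_mx 0 1%:M));
  last by rewrite mul_row_col mulmx0 !mulmx1 add0r.
move=> <-.
by rewrite -[X in row_mx X _](mulmx1 B) -[X in row_mx _ X](mulmx0 _ B) -mul_mx_row
  mulmx_max_rank.
Qed.

End Determinants.

(** * Connectivity and acyclicity after adding an edge *)

Section Connectivity.
Variable G : graph.
Implicit Types (F S : {set edge G}) (e f : edge G) (u v : vertex G).

Lemma adjP S u v :
  reflect (exists2 e, e \in S & src e = u /\ tgt e = v) (adj S u v).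
Proof.
apply: (iffP exists_inP) => -[e eS].
  by case/andP=> /eqP <- /eqP <-; exists e.
by case=> <- <-; exists e => //; rewrite !eqxx.
Qed.

Lemma adj_edge S e : e \in S -> adj S (src e) (tgt e).
Proof. by move=> eS; apply/adjP; exists e. Qed.

Lemma connect_adj_sub S S' : S \subset S' ->
  subrel (connect (adj S)) (connect (adj S')).
Proof.
move=> sub; apply: connect_sub => u v /adjP[e eS [<- <-]].
by apply/connect1/adj_edge/(subsetP sub).
Qed.

Lemma connect_adj_sym S : subgraph S -> connect_sym (adj S).
Proof.
move=> subS; apply: sym_connect_sym => u v.
by apply/adjP/adjP => -[e /subS eS [<- <-]]; exists (einv e) => //;
  rewrite src_einv tgt_einv.
Qed.

(** Later proofs argue with such invariants of edges instead of following paths. *)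
Lemma connect_adj_const (T : eqType) (f : vertex G -> T) S u v :
  {in S, forall e, f (src e) = f (tgt e)} -> connect (adj S) u v -> f u = f v.
Proof.
move=> fS /connectP[p]; elim: p u => [|w p IH] u /=; first by move=> _ ->.
by case/andP=> /adjP[e /fS eq_f [<- <-]] pth lst; rewrite eq_f; exact: IH.
Qed.

Lemma connect_set0 u v : connect (adj set0) u v = (u == v).
Proof.
apply/idP/eqP => [|-> //]; apply: connect_adj_const => e.
by rewrite inE.
Qed.

Definition add_edge F e : {set edge G} := [set e; einv e] :|: F.

Lemma subgraph_add F e : subgraph F -> subgraph (add_edge F e).
Proof.
move=> subF f; rewrite !inE => /orP[/orP[]/eqP->|/subF ->]; rewrite ?einvK ?eqxx ?orbT //.
Qed.

Lemma subgraphV F e : subgraph F -> (einv e \in F) = (e \in F).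
Proof. by move=> subF; apply/idP/idP => /subF //; rewrite einvK. Qed.

Lemma connect_add F e u v : subgraph F ->
  connect (adj (add_edge F e)) u v =
    [|| connect (adj F) u v,
        connect (adj F) u (src e) && connect (adj F) v (tgt e)
      | connect (adj F) u (tgt e) && connect (adj F) v (src e)].
Proof.
move=> subF; have symF := connect_adj_sym subF.
have symF' := connect_adj_sym (subgraph_add (e := e) subF).
have subFF' := connect_adj_sub (subsetUr [set e; einv e] F).
have ee' : connect (adj (add_edge F e)) (src e) (tgt e).
  by apply/connect1/adj_edge; rewrite !inE eqxx.
apply/idP/idP; last first.
  case/or3P=> [/subFF' // |/andP[/subFF' us /subFF' vt]|/andP[/subFF' ut /subFF' vs]].
    by apply: connect_trans us (connect_trans ee' _); rewrite symF'.
  by rewrite symF' (connect_trans vs) // (connect_trans ee') // symF'.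
(* The component of [w], with that of [src e] renamed to that of [tgt e]. *)
pose g w := [set z | if connect (adj F) w (src e) then connect (adj F) (tgt e) z
                     else connect (adj F) w z].
have gE w z : g w = g z -> connect (adj F) w (src e) = false ->
    connect (adj F) z (src e) = false -> connect (adj F) w z.
  by move=> /setP /(_ z) gg ws zs; rewrite !inE ws zs connect0 in gg.
move=> uv; have : g u = g v.
  apply: connect_adj_const uv => f; rewrite !inE.
  move=> /orP[/orP[]/eqP->|fF]; rewrite ?src_einv ?tgt_einv.
  - apply/setP => z; rewrite !inE connect0; case: ifP => // ts.
  - by apply/setP => z; rewrite !inE connect0; case: ifP => // ts.
  - have cf := connect1 (adj_edge fF).
    by apply/setP => z; rewrite !inE !(same_connect symF cf).
(* If exactly one of [u], [v] is joined to [src e], evaluating [g u = g v] at the other one shows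
   that it is joined to [tgt e]. *)
case us: (connect (adj F) u (src e)); case vs: (connect (adj F) v (src e)) => guv.
- by apply/orP; left; apply: connect_trans us _; rewrite symF.
- move/setP/(_ v): guv; rewrite !inE us vs connect0 /= => tv.
  by rewrite [connect _ v (tgt e)]symF tv /= orbT.
- move/setP/(_ u): guv; rewrite !inE us vs connect0 => /esym tu.
  by rewrite [connect _ u (tgt e)]symF tu /= orbT.
- by rewrite gE.
Qed.

Local Notation step := (fun e f => (tgt e == src f) && (f != einv e)).

(** The edge [e] enters the path at [v] and is kept so that its junction with the first edge is
    controlled too. Only this junction needs a hypothesis: a later backtrack would return to a
    visited vertex. *)
Lemma edges_of_path F e v p :
    path (adj F) v p -> uniq (v :: p) -> tgt e = v ->
    (forall f, f \in F -> tgt f \in p -> f != einv e) ->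
  exists es, [/\ all [in F] es, [seq src f | f <- es] = belast v p,
    path step e es & tgt (last e es) = last v p].
Proof.
elim: p v e => [|w p IH] v e /=; first by exists [::].
case/andP=> /adjP[f fF [sf tf]] pth /andP[vp up] te noback.
case: (IH w f pth up tf) => [g gF gp|es [esF srcs pes lst]].
  by apply/eqP => gf; rewrite gf tgt_einv sf in gp; rewrite inE gp orbT in vp.
exists (f :: es); split=> /=; rewrite ?fF ?srcs ?sf ?pes ?andbT ?te ?eqxx //=.
by apply: noback => //; rewrite tf mem_head.
Qed.

Lemma connect_edges F e es : all [in F] es -> path step e es ->
  connect (adj F) (tgt e) (tgt (last e es)).
Proof.
elim: es e => [|f es IH] e //= /andP[fF esF] /andP[/andP[/eqP-> _] pes].
exact: connect_trans (connect1 (adj_edge fF)) (IH _ esF pes).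
Qed.

Lemma acyclic_sub S S' : S \subset S' -> acyclic S' -> acyclic S.
Proof.
move=> /subsetP sub acy c; apply: contra (acy c).
case/and4P=> c0 cS cu cc; apply/and4P; split=> //.
by apply/allP => f /(allP cS) /sub.
Qed.

Lemma acyclic_set0 : acyclic (set0 : {set edge G}).
Proof. by case=> [|e c] //; rewrite /simple_cycle /= inE. Qed.

(** A simple path in [F] from [tgt e] to [src e] is closed by [e] into a cycle. Conversely, a cycle
    through [e] or [einv e], rotated to start there, leaves a path in [F] joining the ends of
    [e]. *)
Lemma acyclic_add F e : subgraph F -> e \notin F ->
  acyclic (add_edge F e) <-> acyclic F /\ ~~ connect (adj F) (src e) (tgt e).
Proof.
move=> subF eF; have symF := connect_adj_sym subF.
split=> [acy|[acy nc] c].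
  split; first exact: acyclic_sub (subsetUr _ _) acy.
  rewrite symF; apply/negP => /connectP[p0 pth0 lst0].
  case/shortenP: pth0 lst0 => p pth up _ lst.
  case: (edges_of_path pth up (erefl (tgt e))) => [f fF _|es [esF srcs pes lst_es]].
    by apply: contraNneq eF => fe; rewrite -subgraphV // -fe.
  have := acy (e :: es); rewrite /simple_cycle /= rcons_path pes lst_es -lst eqxx /=.
  rewrite !inE eqxx /= srcs -rcons_uniq lst -lastI up /=.
  have -> /= : all [in add_edge F e] es.
    by apply: sub_all esF => f fF; rewrite !inE fF orbT.
  (* Only the closing junction can fail: [e] would be the inverse of the last edge, hence its own
     inverse or an element of [F]. *)
  rewrite negbK => /eqP el; have := mem_last e es; rewrite inE => /orP[/eqP le|].
    by have := einv_neq e; rewrite -{1}le -el eqxx.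
  move=> /(allP esF) /subF; rewrite -el => ein.
  by rewrite ein in eF.
apply/negP => /and4P[c0 cS cu cc].
have [cF|] := boolP (all [in F] c).
  by have := acy c; rewrite /simple_cycle c0 cF cu cc.
case/allPn=> f fc fF.
have fe : (f == e) || (f == einv e).
  by have := allP cS f fc; rewrite !inE (negPf fF) orbF.
have ncf : ~~ connect (adj F) (tgt f) (src f).
  by case/orP: fe => /eqP->; rewrite ?src_einv ?tgt_einv // symF.
case/rot_to: fc => i p rotc.
move: cc; rewrite -(rot_cycle i) rotc /= rcons_path => /andP[pp /andP[/eqP lp _]].
have up : uniq [seq src g | g <- f :: p] by rewrite -rotc map_rot rot_uniq.
case/negP: ncf; rewrite -lp; apply: connect_edges => //.
apply/allP => g gp; apply/negPn/negP => gF.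
have gc : g \in c by rewrite -(mem_rot i) rotc inE gp orbT.
have ge : (g == e) || (g == einv e).
  by have := allP cS g gc; rewrite !inE (negPf gF) orbF.
have : (g == f) || (g == einv f).
  by move: fe ge => /orP[]/eqP-> /orP[]/eqP->; rewrite ?einvK ?eqxx ?orbT.
case/orP=> /eqP gf; first by move: up; rewrite /= -gf map_f.
(* The edge [h] after [f] has the same source as [einv f]: either [h] is [einv f] and the cycle
   backtracks, or [einv f] occurs later and repeats a source. *)
case: p {rotc lp} pp up gp => // h p /= /andP[/andP[/eqP fh hf] _].
case/and3P=> _ hp _; rewrite inE gf eq_sym (negPf hf) /= => fp.
by move: hp; rewrite -fh -src_einv map_f.
Qed.

End Connectivity.

(** * Contraction of the components of a forest *)

Section Labellings.
Variable G : graph.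
Implicit Types (F S : {set edge G}) (e f : edge G) (u v : vertex G).

(** A numbering of the components, left arbitrary: contracting an edge produces a numbering which
    need not be [component_index]. *)
Definition labelling F c (p : vertex G -> 'I_c) : Prop :=
  (forall i, exists v, p v = i) /\
  (forall u v, (p u == p v) = connect (adj F) u v).

(** The map [s] reads the label under [p'] of a vertex chosen in each class of [p]. *)
Lemma labelling_inj F c c' (p : vertex G -> 'I_c) (p' : vertex G -> 'I_c') :
  labelling F p -> labelling F p' ->
  exists2 s : 'I_c -> 'I_c', injective s & forall v, p' v = s (p v).
Proof.
move=> [surj ker] [_ ker'].
have rep i : {v | p v == i}.
  by apply: sigW; have [v <-] := surj i; exists v.
have repE i : p (sval (rep i)) = i by apply/eqP/(svalP (rep i)).
exists (fun i => p' (sval (rep i))) => [i j /eqP|v].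
  by rewrite ker' -ker !repE => /eqP.
by apply/eqP; rewrite ker' -ker repE.
Qed.

Lemma labelling_card_eq F c c' (p : vertex G -> 'I_c) (p' : vertex G -> 'I_c') :
  labelling F p -> labelling F p' -> c = c'.
Proof.
move=> lp lp'; apply/eqP; rewrite eqn_leq.
have [s s_inj _] := labelling_inj lp lp'; have [s' s'_inj _] := labelling_inj lp' lp.
by have := leq_card s s_inj; have := leq_card s' s'_inj; rewrite !card_ord => -> ->.
Qed.

Lemma mem_components F v : [set w | connect (adj F) v w] \in components F.
Proof. exact: imset_f. Qed.

Definition component_index F v : 'I_#|components F| :=
  enum_rank_in (mem_components F v) [set w | connect (adj F) v w].

Lemma component_indexP F : subgraph F -> labelling F (component_index F).
Proof.
move=> subF; have symF := connect_adj_sym subF.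
have idxK v : enum_val (component_index F v) = [set w | connect (adj F) v w].
  exact: enum_rankK_in (mem_components F v).
split=> [i|u v].
  have /imsetP[v _ iv] := enum_valP i; exists v; apply: enum_val_inj.
  by rewrite idxK iv.
rewrite -(inj_eq enum_val_inj) !idxK; apply/eqP/idP => [/setP/(_ v)|uv].
  by rewrite !inE connect0.
by apply/setP => w; rewrite !inE (same_connect symF uv).
Qed.

Lemma labelling_card F c (p : vertex G -> 'I_c) :
  subgraph F -> labelling F p -> #|components F| = c.
Proof. by move=> /component_indexP lF /(labelling_card_eq lF). Qed.

Lemma labelling_set0 : labelling (set0 : {set edge G}) enum_rank.
Proof.
split=> [i|u v]; first by exists (enum_val i); rewrite enum_valK.
by rewrite connect_set0 (inj_eq enum_rank_inj).
Qed.

(** The label of [tgt e] is given up in favour of that of [src e], and [lift] renumbers the others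
    around the gap, just as [merge_mx] deletes a row. *)
Lemma labelling_add F e c (p : vertex G -> 'I_c.+1) :
    subgraph F -> labelling F p -> p (src e) != p (tgt e) ->
  exists2 p' : vertex G -> 'I_c, labelling (add_edge F e) p' &
    forall v, lift (p (tgt e)) (p' v) = if p v == p (tgt e) then p (src e) else p v.
Proof.
move=> subF [surj ker]; set a := p (src e); set b := p (tgt e) => ab.
pose r i := if i == b then a else i.
have rb i : r i != b by rewrite /r; case: ifPn.
have ex v : {j | lift b j == r (p v)}.
  by apply: sigW; have := rb (p v); rewrite eq_sym => /unlift_some[j -> _]; exists j.
exists (fun v => sval (ex v)) => [|v]; last exact/eqP/(svalP (ex v)).
have exE v : lift b (sval (ex v)) = r (p v) by apply/eqP/(svalP (ex v)).
split=> [i|u v].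
  have [v pv] := surj (lift b i); exists v; apply: (@lift_inj _ b).
  by rewrite exE pv /r eq_sym (negPf (neq_lift _ _)).
rewrite -(inj_eq (@lift_inj _ b)) !exE connect_add // -!ker -/a -/b /r.
have [->|ub] := eqVneq (p u) b; have [->|vb] := eqVneq (p v) b; rewrite ?eqxx //=.
- by rewrite ?andbF /= eq_sym.
- by rewrite (negPf ub) andbT orbF.
- by rewrite !andbF !orbF.
Qed.

End Labellings.

(** * Determinants of contracted bordered matrices *)

Section Contraction.
Variables (K : fieldType) (G : graph).
Implicit Types (F S : {set edge G}) (e f : edge G) (u v : vertex G).
Local Notation n := #|vertex G|.

(** For a labelling [p] of [F], this is the matrix [P_F]. *)
Definition label_mx c (p : vertex G -> 'I_c) : 'M[K]_(c, n) :=
  \matrix_(i, j) (p (enum_val j) == i)%:R.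

Lemma mul_label_mx c (p : vertex G -> 'I_c) r (A : 'M[K]_(n, r)) i j :
  (label_mx p *m A) i j = \sum_(v | p v == i) A (enum_rank v) j.
Proof.
rewrite mxE (reindex_onto enum_rank enum_val) /=; last by move=> ? _; rewrite enum_valK.
rewrite [RHS]big_mkcond [LHS]big_mkcond; apply: eq_bigr => v _.
by rewrite enum_rankK eqxx mxE enum_rankK; case: eqP; rewrite ?mul1r ?mul0r.
Qed.

Definition incidence e : 'cV[K]_n :=
  \col_i ((enum_val i == tgt e)%:R - (enum_val i == src e)%:R).

Lemma label_mx_incidence c (p : vertex G -> 'I_c) e :
  label_mx p *m incidence e = delta_mx (p (tgt e)) 0 - delta_mx (p (src e)) 0.
Proof.
apply/colP => i; rewrite mul_label_mx !mxE.
under eq_bigr do rewrite mxE enum_rankK.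
rewrite sumrB !(big_mkcond (fun v => p v == i)) /= (bigD1 (tgt e)) //= eqxx.
rewrite [X in _ - X](bigD1 (src e)) //= eqxx !big1 ?addr0.
- by rewrite ![i == _]eq_sym !andbT; do 2!case: (_ == i).
- by move=> v /negPf ->; case: ifP.
- by move=> v /negPf ->; case: ifP.
Qed.

Section Bordered.
Variable m : nat.
Implicit Type M : 'M[K]_(n + m).

Definition border c (P : 'M[K]_(c, n)) : 'M[K]_(c + m, n + m) :=
  block_mx P 0 0 1%:M.

Definition contract F M : K :=
  let P := border (label_mx (component_index F)) in \det (P *m M *m P^T).

(** Two labellings differ by a permutation of the labels, which acts on both sides of the matrix, so
    its sign occurs squared. *)
Lemma contractE F c (p : vertex G -> 'I_c) M : subgraph F -> labelling F p ->
  contract F M = \det (border (label_mx p) *m M *m (border (label_mx p))^T).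
Proof.
move=> subF lp; have lF := component_indexP subF.
rewrite /contract; move: (component_index F) lF (labelling_card subF lp).
move=> p0 lp0 ec; rewrite ec in p0 lp0 *.
have [s s_inj ps] := labelling_inj lp0 lp.
pose X : 'M[K]_(c + m) := block_mx (perm_mx (perm s_inj))^T 0 0 1%:M.
have -> : border (label_mx p) = X *m border (label_mx p0).
  rewrite mulmx_block !(mul0mx, mulmx0, addr0, add0r) mul1mx; congr block_mx.
  apply/matrixP => i j; rewrite !mxE (bigD1 (p0 (enum_val j))) //= big1 => [|l /negPf pl].
    by rewrite !mxE permE eqxx mulr1 addr0 ps.
  by rewrite !mxE [_ == l]eq_sym pl mulr0.
have detX : \det X * \det X = 1.
  by rewrite det_ublock det1 mulr1 det_tr det_perm -expr2 sqrr_sign.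
by rewrite trmx_mul !mulmxA -(mulmxA X) -(mulmxA X) !det_mulmx (det_tr X)
  mulrAC detX mul1r.
Qed.

(* A border amounts to isolated extra vertices, each with its own label. *)
Definition border_label c (p : vertex G -> 'I_c) (j : 'I_(n + m)) : 'I_(c + m) :=
  match split j with
  | inl v => lshift m (p (enum_val v))
  | inr l => rshift c l
  end.

Lemma border_labelE c (p : vertex G -> 'I_c) i j :
  border (label_mx p) i j = (border_label p j == i)%:R.
Proof.
rewrite /border /border_label -(splitK i) -(splitK j) unsplitK.
case: (split i) => i'; case: (split j) => j' /=.
- by rewrite block_mxEul mxE (inj_eq (@lshift_inj _ _)).
- by rewrite block_mxEur mxE eq_rlshift.
- by rewrite block_mxEdl mxE eq_lrshift.
- by rewrite block_mxEdr mxE (inj_eq (@rshift_inj _ _)) eq_sym.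
Qed.

(** Each column of either border is a basis vector, so it suffices to follow labels. The ascriptions
    rely on [c.+1 + m] and [(c + m).+1] being convertible. *)
Lemma border_merge c (p : vertex G -> 'I_c.+1) (p' : vertex G -> 'I_c) (a b : 'I_c.+1) :
    a != b -> (forall v, lift b (p' v) = if p v == b then a else p v) ->
  border (label_mx p') =
    merge_mx K (lshift m a) (lshift m b) *m border (label_mx p).
Proof.
move=> ab p'E; set a' : 'I_(c + m).+1 := lshift m a; set b' : 'I_(c + m).+1 := lshift m b.
have bE (i : 'I_(n + m)) : lift b' (border_label p' i) =
    if border_label p i == b' :> 'I_(c + m).+1 then a' else border_label p i.
  rewrite /border_label; case: (split i) => [v|l].
    rewrite (_ : (_ == b') = (p (enum_val v) == b));
      last exact: (inj_eq (@lshift_inj _ _)).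
    by apply: val_inj; have /(congr1 val) := p'E (enum_val v); case: ifP.
  rewrite (_ : (_ == b') = false); last first.
    by rewrite -val_eqE /= gtn_eqF // ltn_addr.
  (* The extra labels lie above [b], so [lift] moves them by one, from [c + l] to [c.+1 + l]. *)
  by apply: val_inj; rewrite /= /bump (leq_trans (ltn_ord b : (b <= c)%N)) ?leq_addr.
apply/matrixP => i j.
rewrite [RHS]mxE (bigD1 (border_label p j : 'I_(c + m).+1)) //= big1 => [|l /negPf pl].
  rewrite (border_labelE p') (border_labelE p) eqxx mulr1 addr0 !mxE.
  rewrite -(inj_eq (@lift_inj _ b')) bE.
  have [->|pb] := eqVneq (border_label p j : 'I_(c + m).+1) b'.
    by rewrite [lift b' i == b']eq_sym (negPf (neq_lift _ _)) add0r andbT eq_sym.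
  by rewrite andbF addr0 eq_sym.
by rewrite (border_labelE p) [_ == l]eq_sym pl mulr0.
Qed.

Lemma contract_set0 M : contract set0 M = \det M.
Proof.
rewrite (contractE _ _ (@labelling_set0 G)) => [|e]; last by rewrite inE.
have -> : label_mx (@enum_rank (vertex G)) = 1%:M.
  by apply/matrixP => i j; rewrite !mxE enum_valK eq_sym.
by rewrite /border -scalar_mx_block mul1mx trmx1 mulmx1.
Qed.

(** Deletion and contraction: [P] maps the column of [e] to a difference of two basis vectors, where
    [det_rank1_update] applies, or to [0] if both ends of [e] have the same label. *)
Lemma contract_add F e M x : subgraph F ->
  contract F (M + x *: (col_mx (incidence e) 0 *m (col_mx (incidence e) 0)^T))
   = contract F M
     + (~~ connect (adj F) (src e) (tgt e))%:R * (x * contract (add_edge F e) M).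
Proof.
move=> subF; have lF := component_indexP subF.
rewrite /contract.
set P := border _; set d := col_mx _ _.
have -> : P *m (M + x *: (d *m d^T)) *m P^T
    = P *m M *m P^T + x *: ((P *m d) *m (P *m d)^T).
  by rewrite mulmxDr mulmxDl -scalemxAr -scalemxAl trmx_mul !mulmxA.
have Pd : P *m d = col_mx (label_mx (component_index F) *m incidence e) 0.
  by rewrite mul_block_col !(mul0mx, mulmx0) !addr0.
rewrite -(proj2 lF).
move: Pd lF; rewrite label_mx_incidence /P {P}.
(* The component of [src e] exists, so the number of labels has the form [c.+1] required by
   [merge_mx]. *)
case: #|components F| (component_index F) => [|c] p; first by case: (p (src e)).
move=> Pd lp; have [eqst|ne_st] := eqVneq (p (src e)) (p (tgt e)).
  by rewrite mul0r addr0 Pd eqst subrr col_mx0 mul0mx scaler0 addr0.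
have [p' lp' p'E] := labelling_add subF lp ne_st.
rewrite mul1r -/(contract _ _) (contractE _ (subgraph_add (e := e) subF) lp').
set a := p (src e) in ne_st p'E Pd *; set b := p (tgt e) in ne_st p'E Pd *.
rewrite (@det_rank1_update _ (c + m) _ (lshift m a) (lshift m b)).
- congr (_ + _ * \det _).
  by rewrite (border_merge ne_st p'E) trmx_mul !mulmxA.
- by apply: contra_neq ne_st => eq_ab; exact: (@lshift_inj c.+1 m a b eq_ab).
- rewrite Pd; apply/matrixP => i j; rewrite ord1.
  have [[i'|i'] ->] : exists z, i = @unsplit c.+1 m z.
    by exists (@split c.+1 m i); rewrite (@splitK c.+1 m).
  - by rewrite [LHS]col_mxEu !mxE -!val_eqE.
  - have ne (q : 'I_c.+1) : ((c.+1 + i')%N == q) = false.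
      by rewrite gtn_eqF // ltn_addr.
    by rewrite [LHS]col_mxEd !mxE -!val_eqE /= !ne subr0.
Qed.

End Bordered.
End Contraction.

(** * Expansion over forests *)

Section ForestExpansion.
Variables (K : numFieldType) (G : graph).
Implicit Types (F S : {set edge G}) (e f : edge G) (x : edge G -> K).
Local Notation n := #|vertex G|.

Definition is_forest F : bool := `[< subgraph F /\ acyclic F >].

Lemma epos_einvF e : e \in epos G -> (einv e \in epos G) = false.
Proof. by rewrite epos_einv => ->. Qed.

Lemma monomialE x F : subgraph F -> monomial x F = \prod_(e in F :&: epos G) x e.
Proof.
move=> subF; rewrite /monomial (_ : F :|: _ = F) //.
by apply/setUidPl/subsetP => _ /imsetP[e eF ->]; exact: subF.
Qed.

(** Of the two added orientations only [e] lies in [epos G], whence a single new factor. *)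
Lemma monomial_add x F e : subgraph F -> e \in epos G -> e \notin F ->
  monomial x (add_edge F e) = x e * monomial x F.
Proof.
move=> subF ep eF; rewrite !monomialE //; last exact: subgraph_add.
rewrite (bigD1 e) ?inE ?eqxx //=; congr (_ * _); apply: eq_bigl => f.
rewrite !inE; have [->|fe] := eqVneq f e; first by rewrite (negPf eF) andbF.
rewrite andbT; have [->|//] := eqVneq f (einv e).
by rewrite epos_einvF // !andbF.
Qed.

Lemma forest_add F e : is_forest F -> e \notin F ->
  is_forest (add_edge F e) = ~~ connect (adj F) (src e) (tgt e).
Proof.
move=> /asboolP[subF acy] eF; apply/asboolP/idP => [[_ /acyclic_add[]]//|nc].
by split; [exact: subgraph_add|apply/acyclic_add].
Qed.

Lemma forest_del F e : is_forest F -> is_forest (F :\: [set e; einv e]).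
Proof.
move=> /asboolP[subF acy]; apply/asboolP; split;
  last exact: acyclic_sub (subsetDl _ _) acy.
move=> f; rewrite !inE => /andP[fe /subF ->]; rewrite andbT.
by rewrite (inj_eq (can_inj (@einvK G))) (can2_eq (@einvK G) (@einvK G)) orbC.
Qed.

Section Expansion.
Variable m : nat.
Implicit Type M : 'M[K]_(n + m).

Definition edge_mx e : 'M[K]_(n + m) :=
  col_mx (incidence K e) 0 *m (col_mx (incidence K e) 0)^T.

Lemma det_forest_expansion x M :
  \det (M + \sum_(e in epos G) x e *: edge_mx e)
    = \sum_(F : {set edge G} | is_forest F) monomial x F * contract F M.
Proof.
(* Each edge of [s] has been either contracted (into [F]) or deleted. *)
suff main s : uniq s -> {subset s <= epos G} ->
    \det (M + \sum_(e in epos G) x e *: edge_mx e)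
    = \sum_(F : {set edge G} | is_forest F &&
          (F \subset [set e | (e \in s) || (einv e \in s)]))
        monomial x F *
        contract F (M + \sum_(e in epos G | e \notin s) x e *: edge_mx e).
  rewrite (main (enum (epos G))) ?enum_uniq // => [|e]; last by rewrite mem_enum.
  apply: eq_big => [F|F _].
    rewrite andb_idr // => _; apply/subsetP => e _; rewrite inE !mem_enum epos_einv.
    exact: orbN.
  by rewrite big1 ?addr0 // => e; rewrite mem_enum andbN.
elim: s => [_ _|e s IH /= /andP[es us] sub].
  rewrite (big_pred1 set0) => [|F /=].
    rewrite contract_set0 monomialE => [|e]; last by rewrite inE.
    rewrite set0I big_set0 mul1r; congr (\det (_ + _)); apply: eq_bigl => e.
    by rewrite andbT.
  apply/andP/eqP => [[_ /subsetP sF]|->].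
    by apply/setP => e; rewrite inE; apply/negP => /sF; rewrite inE.
  rewrite sub0set; split=> //; apply/asboolP; split; last exact: acyclic_set0.
  by move=> e; rewrite inE.
have ep : e \in epos G by rewrite sub ?mem_head.
have sub_s : {subset s <= epos G} by move=> f fs; rewrite sub // inE fs orbT.
have eis : einv e \notin s by apply/negP => /sub_s; rewrite epos_einvF.
rewrite {}IH //.
set M' := M + \sum_(f in epos G | f \notin e :: s) x f *: edge_mx f.
have -> : M + \sum_(f in epos G | f \notin s) x f *: edge_mx f = M' + x e *: edge_mx e.
  rewrite (bigD1 e) ?ep //= addrCA addrC; congr (M + _ + _).
  by apply: eq_bigl => f; rewrite inE negb_or -andbA [_ && (f != e)]andbC.
set D := [set f | (f \in s) || _].
have eD F : F \subset D -> e \notin F.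
  by move=> /subsetP sF; apply/negP => /sF; rewrite inE (negPf es) (negPf eis).
(* Each forest [F] over [s] yields a deletion term, indexed by [F], and, when [e] closes no cycle, a
   contraction term, indexed by [add_edge F e]. *)
transitivity (\sum_(F : {set edge G} | is_forest F && (F \subset D))
   (monomial x F * contract F M' +
    if is_forest (add_edge F e) then
       monomial x (add_edge F e) * contract (add_edge F e) M' else 0)).
  apply: eq_bigr => F /andP[fF /eD eF]; have [subF _] := asboolP _ fF.
  rewrite contract_add // forest_add // mulrDr; congr (_ + _).
  case: ifP => _; last by rewrite mul0r mulr0.
  by rewrite monomial_add // mul1r mulrCA mulrA.
rewrite big_split [RHS](bigID (fun F : {set edge G} => e \in F)) /= addrC; congr (_ + _).
  (* Contraction terms match the forests containing [e]: adding both orientations of [e] is inverse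
     to removing them. *)
  rewrite -big_mkcondr [RHS](reindex_onto (fun F => add_edge F e)
    (fun F => F :\: [set e; einv e])) /=.
    apply: eq_bigl => F; apply/andP/andP=> [[/andP[fF sF] faF]|].
      have eF := eD _ sF; have [subF _] := asboolP _ fF; rewrite faF /=; split.
        apply/andP; split; last by rewrite !inE eqxx.
        apply/subsetP => f; rewrite !inE => /orP[/orP[]/eqP->|/(subsetP sF)].
        - by rewrite eqxx.
        - by rewrite einvK eqxx orbT.
        - by rewrite inE => /orP[]->; rewrite !orbT.
      rewrite /add_edge setDUl setDv set0U; apply/eqP/setDidPl.
      by rewrite disjoint_sym disjoints_subset subUset !sub1set !inE subgraphV // eF.
    case=> /andP[/andP[faF /subsetP saF] _] /eqP FE; split=> //.
    rewrite -{1 2}FE forest_del //=; apply/subsetP => f; rewrite !inE negb_or.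
    case/andP=> /andP[/negPf fe /negPf fie] faf.
    have := saF f; rewrite !inE => /(_ faf); rewrite fe /=.
    by rewrite (can2_eq (@einvK G) (@einvK G)) fie.
  move=> F /andP[/andP[/asboolP[subF _] _] eF].
  rewrite /add_edge setUC setDE setUIl [~: _ :|: _]setUC setUCr setIT.
  apply/setUidPl/subsetP => f; rewrite !inE => /orP[]/eqP-> //; exact: subF.
(* Deletion terms match the forests without [e]: being subgraphs, these avoid [einv e] too and so
   lie over [s]. *)
apply: eq_bigl => F; rewrite -andbA; apply: andb_id2l => /asboolP[subF _].
apply/subsetP/andP => [sF|[/subsetP sF eF] f fF].
  split; last exact/eD/subsetP.
  by apply/subsetP => f /sF; rewrite !inE => /orP[]->; rewrite !orbT.
have /sF := fF; rewrite !inE; have [fe|_] := eqVneq f e; first by rewrite -fe fF in eF.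
have [fe|//] := eqVneq (einv f) e.
by rewrite -fe subgraphV // fF in eF.
Qed.

End Expansion.

Definition laplacian_mx x : 'M[K]_n :=
  \sum_(e in epos G) x e *: (incidence K e *m (incidence K e)^T).

(** Once the Laplacian is expanded, only an antidiagonal block matrix is left to contract, and its
    determinant vanishes unless its blocks are square. The labelling [p] is a parameter so that it
    can be adapted to an enumeration of trees. *)
Lemma det_bordered_laplacian m x (A : 'M[K]_(n, m)) (B : 'M[K]_(m, n))
    (p : {set edge G} -> vertex G -> 'I_m) :
    (forall F, is_forest F -> #|components F| = m -> labelling F (p F)) ->
  \det (block_mx (laplacian_mx x) A (- B) 0)
    = \sum_(F : {set edge G} | is_forest F && (#|components F| == m))
        monomial x F * (\det (label_mx K (p F) *m A) * \det (B *m (label_mx K (p F))^T)).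
Proof.
move=> p_lab.
have -> : block_mx (laplacian_mx x) A (- B) 0
    = block_mx 0 A (- B) 0 + \sum_(e in epos G) x e *: edge_mx m e.
  under [X in _ + X]eq_bigr => e _.
    rewrite /edge_mx tr_col_mx mul_col_row trmx0 !(mulmx0, mul0mx).
    rewrite scale_block_mx !scaler0.
    over.
  have -> (f : edge G -> 'M[K]_n) : \sum_(e in epos G) block_mx (f e) 0 0 (0 : 'M[K]_m)
      = block_mx (\sum_(e in epos G) f e) 0 0 0.
    elim/big_rec2: _ => [|e y1 y2 _ ->]; first by rewrite block_mx0.
    by rewrite add_block_mx !addr0.
  by rewrite add_block_mx !addr0 add0r.
rewrite det_forest_expansion [RHS]big_mkcondr; apply: eq_bigr => F fF.
have [subF _] := asboolP _ fF.
have prod c (l : vertex G -> 'I_c) :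
    border m (label_mx K l) *m block_mx 0 A (- B) 0 *m (border m (label_mx K l))^T
    = block_mx 0 (label_mx K l *m A) (- (B *m (label_mx K l)^T)) 0.
  rewrite /border tr_block_mx !trmx0 trmx1 !mulmx_block !(mulmx0, mul0mx, mulmx1, mul1mx).
  by rewrite !(addr0, add0r, mul0mx) mulNmx.
case: eqP => [cF|/eqP cF].
  by rewrite (contractE _ subF (p_lab _ fF cF)) prod det_antidiag_block.
by rewrite /contract prod det_antidiag_block0 // mulr0.
Qed.

End ForestExpansion.

(** * Labels from an enumeration of the trees of a forest *)

Section TreeLabels.
Variables (G : graph) (k : nat) (F : {set edge G}) (T : 'I_k -> {set vertex G}).
Hypotheses (subF : subgraph F) (cardF : #|components F| = k.+1).
Hypotheses (T_inj : injective T) (T_comp : forall j, T j \in components F).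

(* The label [0] is that of the component left out by the enumeration [T]. *)
Definition tree_label (v : vertex G) : 'I_(1 + k) :=
  if [pick j | v \in T j] is Some j then rshift 1 j else lshift k ord0.

Lemma tree_connect j u v : u \in T j -> (v \in T j) = connect (adj F) u v.
Proof.
have /imsetP[w _ ->] := T_comp j; rewrite !inE => wu.
by rewrite (same_connect (connect_adj_sym subF) wu).
Qed.

Lemma tree_eq j j' v : v \in T j -> v \in T j' -> j = j'.
Proof.
move=> vj vj'; apply: T_inj; apply/setP => w.
by rewrite (tree_connect w vj) (tree_connect w vj').
Qed.

Lemma tree_label_rshift v j : (tree_label v == rshift 1 j) = (v \in T j).
Proof.
rewrite /tree_label; case: pickP => [j' vj'|no]; last by rewrite eq_lrshift no.
rewrite (inj_eq (@rshift_inj _ _)); apply/eqP/idP => [<- //|vj].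
exact: tree_eq vj' vj.
Qed.

(** The [k] distinct trees leave out exactly one component [C0], so all vertices outside them are
    connected to each other. *)
Lemma tree_labelling : labelling F tree_label.
Proof.
have symF := connect_adj_sym subF.
pose comp u := [set w | connect (adj F) u w].
have compE u v : connect (adj F) u v -> comp u = comp v.
  by move=> uv; apply/setP => w; rewrite !inE (same_connect symF uv).
have cardT : #|[set T j | j : 'I_k]| = k by rewrite card_imset // card_ord.
have subT : [set T j | j : 'I_k] \subset components F.
  by apply/subsetP => _ /imsetP[j _ ->].
have /cards1P[C0 C0E] : #|components F :\: [set T j | j : 'I_k]| == 1%N.
  by rewrite cardsD (setIidPr subT) cardT cardF subSnn.
have outE u : (forall j, (u \in T j) = false) -> comp u = C0.
  move=> uT; apply/set1P; rewrite -C0E inE mem_components andbT.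
  by apply/imsetP => -[j _ uj]; have := uT j; rewrite -uj inE connect0.
split=> [i|u v].
  have [[i'|j] ->] : exists z, i = @unsplit 1 k z by exists (split i); rewrite splitK.
    have : C0 \in components F :\: [set T j | j : 'I_k] by rewrite C0E inE.
    case/setDP=> /imsetP[u _ uC0] C0T; exists u; rewrite /tree_label (ord1 i').
    case: pickP => // j uj; case/imsetP: C0T; exists j => //.
    by apply/setP => w; rewrite (tree_connect w uj) uC0 inE.
  have /imsetP[u _ uj] := T_comp j; exists u; apply/eqP.
  by rewrite tree_label_rshift uj inE.
have [j uj|uT] := pickP (fun j => u \in T j).
  have -> : tree_label u = rshift 1 j by apply/eqP; rewrite tree_label_rshift.
  by rewrite eq_sym tree_label_rshift (tree_connect v uj).
have uE : tree_label u = lshift k ord0.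
  by rewrite /tree_label; case: pickP => // j; rewrite uT.
have [j vj|vT] := pickP (fun j => v \in T j).
  have -> : tree_label v = rshift 1 j by apply/eqP; rewrite tree_label_rshift.
  by rewrite tree_label_rshift symF -(tree_connect u vj).
rewrite uE /tree_label; case: pickP => [j|_]; first by rewrite vT.
rewrite eqxx; apply/esym; have := mem_components F v.
have /setP/(_ v) : comp u = comp v by rewrite !outE.
by rewrite !inE connect0.
Qed.

End TreeLabels.

(** * Bordered determinants and the Green function *)

Section GreenFunction.
Variables (K : numFieldType) (conj : {rmorphism K -> K}) (G : graph).
Hypothesis conj_norm : forall z, `|z| ^+ 2 = z * conj z.
Local Notation n := #|vertex G|.
Implicit Types (F : {set edge G}) (x y : edge G -> K) (f : {ffun vertex G -> K^o}).

Lemma conj_ge0 z : 0 <= z -> conj z = z.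
Proof.
move=> z0; have [->|nz] := eqVneq z 0; first exact: rmorph0.
by apply: (mulfI nz); rewrite -conj_norm ger0_norm.
Qed.

(** The hypothesis [conj_norm] covers both kinds of scalars. As [z * conj z] is nonnegative, it is
    fixed by [conj]; then [conj z] is cancelled. *)
Lemma conj_involutive : involutive conj.
Proof.
move=> z; have [->|nz] := eqVneq z 0; first by rewrite !rmorph0.
have cnz : conj z != 0 by rewrite fmorph_eq0.
apply: (mulfI cnz); rewrite -rmorphM (@conj_ge0 (z * conj z)); first exact: mulrC.
by rewrite -conj_norm exprn_ge0.
Qed.

Lemma map_label_mx c (p : vertex G -> 'I_c) : map_mx conj (label_mx K p) = label_mx K p.
Proof. by apply/matrixP => i j; rewrite !mxE rmorph_nat. Qed.

Lemma const_label_mx c (p : vertex G -> 'I_c) :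
  const_mx 1 *m label_mx K p = const_mx 1 :> 'rV_n.
Proof.
apply/rowP => j; rewrite !mxE (bigD1 (p (enum_val j))) //= !mxE eqxx mulr1.
by rewrite big1 ?addr0 // => i /negPf pi; rewrite !mxE eq_sym pi mulr0.
Qed.

Definition func_mx k (q : 'I_k -> {ffun vertex G -> K^o}) : 'M[K]_(n, k) :=
  \matrix_(i, j) q j (enum_val i).

Lemma sum_enum_val (h : vertex G -> K) : \sum_(i < n) h (enum_val i) = \sum_v h v.
Proof.
rewrite [RHS](reindex_onto enum_val enum_rank) => [|v _]; last exact: enum_rankK.
by apply: eq_bigl => i; rewrite enum_valK eqxx.
Qed.

(** Edge by edge: one incidence factor is the differential of [delta v], whose values are integers
    and hence fixed by [conj]; the other computes the differential of [q j]. *)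
Lemma laplacian_mxE x k (q : 'I_k -> {ffun vertex G -> K^o}) :
  laplacian_mx x *m func_mx q = func_mx (fun j => laplacian conj x (q j)).
Proof.
apply/matrixP => i j; rewrite [RHS]mxE comp_lfunE lfunE /= ffunE /dot1.
rewrite mulmx_suml summxE; apply: eq_bigr => e _.
rewrite -scalemxAl -mulmxA mxE -[RHS]mulrA; congr (_ * _).
rewrite mxE big_ord1 !differentialE !mxE !ffunE rmorphB !rmorph_nat.
rewrite ![_ == enum_val i]eq_sym; congr (_ * _).
under eq_bigr do rewrite !mxE mulrBl.
have pick_sum u : \sum_(l < n) (enum_val l == u)%:R * q j (enum_val l) = q j u.
  rewrite (sum_enum_val (fun v => (v == u)%:R * q j v)) (bigD1 u) //= eqxx mul1r.
  by rewrite big1 ?addr0 // => v /negPf->; rewrite mul0r.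
by rewrite sumrB !pick_sum.
Qed.

Lemma tr_laplacian_mx x : (laplacian_mx x)^T = laplacian_mx x :> 'M[K]_n.
Proof.
rewrite /laplacian_mx linear_sum; apply: eq_bigr => e _.
by rewrite linearZ /= trmx_mul trmxK.
Qed.

(** The sum is the pairing with the constant function [1], whose differential is zero. *)
Lemma im_dstar_sum0 x f : f \in im_dstar conj x -> \sum_v (f v : K) = 0.
Proof.
case/memv_imgP=> alpha _ ->.
have := dstar_adjoint conj x [ffun=> 1] alpha.
rewrite /dot0; under eq_bigr do rewrite ffunE rmorph1 mul1r.
move=> ->; apply: big1 => e _; rewrite differentialE !ffunE subrr rmorph0.
by rewrite mulr0 mul0r.
Qed.

(** * Invertibility and the Green function for positive weights *)

Section Positive.
Variable x : edge G -> K.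
Hypotheses (x_gt0 : forall e, 0 < x e) (G_conn : connected [set: edge G]).

Lemma vertices_gt0 : n%:R != 0 :> K.
Proof. by rewrite pnatr_eq0 -lt0n; case: G_conn. Qed.

(** Pairing the Laplacian of [f] with [f] gives the weighted sum of [|df|^2]; its vanishing forces
    [df = 0] on each positive edge, then on each inverse. *)
Lemma laplacian_ker_const f u v : laplacian conj x f = 0 -> f u = f v.
Proof.
move=> Lf; have : dot1 conj x (differential K G f) (differential K G f) = 0.
  rewrite -dstar_adjoint -comp_lfunE -/(laplacian conj x) Lf.
  by rewrite /dot0 big1 // => w _; rewrite ffunE mulr0.
rewrite /dot1; under eq_bigr do rewrite -mulrA [conj _ * _]mulrC -conj_norm differentialE.
move=> /eqP; rewrite psumr_eq0 => [/allP df0|e _]; last first.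
  by rewrite mulr_ge0 ?exprn_ge0 // ltW.
have posE e : e \in epos G -> f (src e) = f (tgt e).
  move=> ep; have := df0 e (mem_index_enum _); rewrite ep /= mulf_eq0 gt_eqF //=.
  by rewrite expf_eq0 /= normr_eq0 subr_eq0 => /eqP.
apply: (@connect_adj_const G _ f setT) => [e _|]; last by case: G_conn.
have [|ep] := boolP (e \in epos G); first exact: posE.
by have := posE (einv e); rewrite epos_einv src_einv tgt_einv => /(_ ep).
Qed.

Lemma laplacian_ker0 f : laplacian conj x f = 0 -> \sum_v (f v : K) = 0 -> f = 0.
Proof.
move=> Lf sf; apply/ffunP => v; rewrite ffunE; move: sf.
under eq_bigr do rewrite (laplacian_ker_const _ v Lf).
by move=> /eqP; rewrite sumr_const -mulr_natl mulf_eq0 (negPf vertices_gt0) => /eqP.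
Qed.

(** A constant function of sum zero is zero, so [lap_res] is injective and [^-1] is its true
    inverse. *)
Lemma laplacian_green u : laplacian conj x (vsval (green conj x u)) = vsval u.
Proof.
have ker0 : lker (linfun (@lap_res _ conj G x)) == 0%VS.
  rewrite -subv0; apply/subvP => w; rewrite memv_ker lfunE memv0 /=.
  move=> /eqP/(congr1 vsval) /= Lw.
  rewrite -val_eqE /=; apply/eqP/laplacian_ker0 => //.
  exact: im_dstar_sum0 (subvsP w).
by have := lker0_lfunVK ker0 u; rewrite lfunE => /(congr1 vsval).
Qed.

(** A kernel vector [(w, s)] satisfies [L w = s 1] and has [w] of sum zero. Summing the first
    equation over the vertices gives [s = 0], and then [w = 0]. This yields [psi1 y != 0] without
    exhibiting a spanning tree. *)
Lemma det_bordered_laplacian1_neq0 :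
  \det (block_mx (laplacian_mx x) (const_mx 1) (- const_mx 1) (0 : 'M_1)) != 0.
Proof.
apply/negP => /det0P[v]; rewrite -[v]hsubmxK; move: (lsubmx v) (rsubmx v) => w s nz.
rewrite mul_row_block -row_mx0 mulmx0 addr0 => /eq_row_mx[Lw sumw].
pose f : {ffun vertex G -> K^o} := [ffun u => w 0 (enum_rank u)].
have fw : func_mx (fun _ : 'I_1 => f) = w^T.
  by apply/matrixP => i j; rewrite !mxE ffunE enum_valK ord1.
have sum_f : \sum_u (f u : K) = 0.
  transitivity ((w *m const_mx 1 : 'M_1) 0 0); last by rewrite sumw mxE.
  rewrite mxE -(sum_enum_val (fun u => f u)).
  by apply: eq_bigr => i _; rewrite ffunE enum_valK [const_mx 1 _ _]mxE mulr1.
have Lf u : laplacian conj x f u = s 0 0.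
  have /matrixP/(_ (enum_rank u) 0) := laplacian_mxE x (fun _ : 'I_1 => f).
  rewrite [RHS]mxE enum_rankK => <-.
  rewrite fw -[laplacian_mx x]tr_laplacian_mx -trmx_mul.
  move/eqP: Lw; rewrite mulmxN subr_eq0 => /eqP ->.
  by rewrite !mxE big_ord1 mxE mulr1.
have s0 : s 0 0 = 0.
  have /eqP := im_dstar_sum0 (laplacian_im conj x f).
  under eq_bigr do rewrite Lf.
  by rewrite sumr_const -mulr_natl mulf_eq0 (negPf vertices_gt0) => /eqP.
have f0 : f = 0 by apply: laplacian_ker0 sum_f; apply/ffunP => u; rewrite Lf s0 ffunE.
case/negP: nz; apply/eqP; rewrite -row_mx0; congr row_mx.
  apply/rowP => i; move/ffunP/(_ (enum_val i)): f0.
  by rewrite !ffunE enum_valK mxE.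
by apply/matrixP => i j; rewrite !ord1 s0 mxE.
Qed.

(** Right multiplication by [U] subtracts the combination [L H] from the columns [Q], with [H] the
    values of the Green function. It clears [Q], leaves the border of ones unchanged since the
    columns of [H] have sum zero, and creates [Qs *m H] in the corner. *)
Lemma det_bordered_laplacian_green k (q : 'I_k -> subvs_of (im_dstar conj x)) :
  let A := row_mx (const_mx 1) (func_mx (fun j => vsval (q j))) : 'M_(n, 1 + k) in
  \det (block_mx (laplacian_mx x) A (- (map_mx conj A)^T) 0)
    = \det (block_mx (laplacian_mx x) (const_mx 1) (- const_mx 1) (0 : 'M_1))
      * \det (\matrix_(i, j) dot0 conj (vsval (q i)) (vsval (green conj x (q j)))).
Proof.
rewrite /=; set L := laplacian_mx x; set Q := func_mx _; set A := row_mx _ Q.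
pose one : 'cV[K]_n := const_mx 1; pose Qs := (map_mx conj Q)^T.
pose H := func_mx (fun j => vsval (green conj x (q j))).
have LH : L *m H = Q.
  by rewrite laplacian_mxE; apply/matrixP => i j; rewrite !mxE laplacian_green.
have oneH : one^T *m H = 0.
  apply/matrixP => i j; rewrite [RHS]mxE.
  rewrite -[RHS](im_dstar_sum0 (subvsP (green conj x (q j)))).
  rewrite mxE -(sum_enum_val (fun v => vsval (green conj x (q j)) v)).
  by apply: eq_bigr => l _; rewrite !mxE mul1r.
have QH : Qs *m H = \matrix_(i, j) dot0 conj (vsval (q i)) (vsval (green conj x (q j))).
  apply/matrixP => i j; rewrite [LHS]mxE [RHS]mxE /dot0.
  rewrite -(sum_enum_val
    (fun v => conj (vsval (q i) v) * vsval (green conj x (q j)) v)).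
  by apply: eq_bigr => l _; rewrite !mxE.
have Bs : (map_mx conj A)^T = col_mx one^T Qs.
  rewrite map_row_mx tr_row_mx; congr col_mx; rewrite map_const_mx rmorph1 //.
pose U : 'M[K]_(n + (1 + k)) := block_mx 1%:M (row_mx 0 (- H)) 0 1%:M.
have detU : \det U = 1 by rewrite det_ublock !det1 mulr1.
have detc n1 n2 (e1 e2 : n1 = n2) (M : 'M[K]_n1) : \det (castmx (e1, e2) M) = \det M.
  by case: _ / e1 e2 => e2; rewrite castmx_id.
transitivity (\det (block_mx L A (- (map_mx conj A)^T) 0 *m U)).
  by rewrite det_mulmx detU mulr1.
rewrite mulmx_block !(mulmx0, mulmx1, mul0mx, addr0) Bs !mul_mx_row mulmx0 mulmxN LH.
rewrite add_row_mx add0r addNr !mulNmx mulmxN opprK mulmx0 oppr0.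
rewrite mul_col_mx oneH QH opp_col_mx.
set D := \matrix_(i, j) _.
have -> : row_mx 0 (col_mx 0 D) = block_mx 0 0 0 D :> 'M_(1 + k).
  by rewrite block_mxEh col_mx0.
(* Regrouping the index [n + (1 + k)] as [(n + 1) + k] makes the matrix block lower triangular, up
   to a cast. *)
by rewrite block_mxA detc col_mx0 det_lblock trmx_const.
Qed.

End Positive.

(** No sign appears because the omitted tree has label [0]: its row comes first. *)
Lemma det_label_tree k F (T : 'I_k -> {set vertex G})
    (q : 'I_k -> {ffun vertex G -> K^o}) :
    subgraph F -> #|components F| = k.+1 ->
    injective T -> (forall j, T j \in components F) ->
    (forall j, \sum_v (q j v : K) = 0) ->
  \det (label_mx K (tree_label T) *m row_mx (const_mx 1) (func_mx q))
    = n%:R * \det (\matrix_(i, j) \sum_(v in T j) (q i v : K)).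
Proof.
move=> subF cF T_inj T_comp sum_q; set P := label_mx K _; set A := row_mx _ _.
set S := \matrix_(i, j) _.
(* Left multiplication by [X] replaces the first row by the sum of all rows, which is
   [(n, 0, .., 0)] since each [q j] has sum zero. *)
pose X : 'M[K]_(1 + k) := block_mx 1%:M (const_mx 1) 0 1%:M.
have X1 : row_mx 1%:M (const_mx 1) = const_mx 1 :> 'rV[K]_(1 + k).
  rewrite -[RHS]row_mx_const; congr row_mx.
  by apply/matrixP => i j; rewrite !ord1 !mxE.
have detX : \det X = 1 by rewrite det_ublock !det1 mulr1.
transitivity (\det (X *m P *m A)); first by rewrite -mulmxA det_mulmx detX mul1r.
have -> : X *m P *m A = col_mx (row_mx n%:R%:M 0) (dsubmx (P *m A)).
  rewrite /X /block_mx X1 !mul_col_mx const_label_mx -mulmxA; congr col_mx.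
    rewrite mul_mx_row; congr row_mx.
      apply/matrixP => i j; rewrite !ord1 !mxE (eq_bigr (fun _ => 1)) => [|l _].
        by rewrite sumr_const card_ord.
      by rewrite !mxE mulr1.
    apply/matrixP => i j; rewrite [RHS]mxE -[RHS](sum_q j) mxE.
    rewrite -(sum_enum_val (fun v => q j v)).
    by apply: eq_bigr => l _; rewrite !mxE mul1r.
  by rewrite -[P *m A in LHS]vsubmxK mul_row_col mul0mx mul1mx add0r.
rewrite -[dsubmx _]hsubmxK -/(block_mx _ _ _ _) det_lblock det_scalar1.
rewrite -(det_tr S); congr (_ * \det _); apply/matrixP => i j.
rewrite 2!mxE mul_label_mx [RHS]mxE [RHS]mxE.
apply: eq_big => [v|v _]; first exact: (tree_label_rshift subF T_inj T_comp).
by rewrite row_mxEr !mxE enum_rankK.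
Qed.

Lemma mem_forests k F : (F \in forests G k) = is_forest F && (#|components F| == k.+1).
Proof.
rewrite inE; apply/asboolP/andP => [[subF acy cF]|[/asboolP[subF acy] /eqP cF]] //.
by rewrite cF; split=> //; apply/asboolP.
Qed.

Lemma mem_spanning_trees F : (0 < n)%N ->
  (F \in spanning_trees G) = is_forest F && (#|components F| == 1).
Proof.
move=> n0; rewrite inE; apply/asboolP/andP.
  case=> subF [_ con] acy; split; first exact/asboolP.
  apply/eqP/(@labelling_card _ _ _ (fun _ => ord0 : 'I_1)) => //.
  split=> [i|u v]; last by rewrite eqxx con.
  by have /card_gt0P[v _] := n0; exists v; rewrite (ord1 i).
case=> /asboolP[subF acy] /eqP cF.
split=> //; split=> // u v; have [_ <-] := component_indexP subF.
by move: (component_index F); rewrite cF => p; rewrite !ord1.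
Qed.

(** The factors over [F] cancel between [y] and [x]; this turns the expansion in [x^F] into one in
    [y] over complements. *)
Lemma monomialC x y F : (forall e, 0 < y e) -> (forall e, x e = (y e)^-1) -> subgraph F ->
  monomial y (~: F) = monomial y [set: edge G] * monomial x F.
Proof.
move=> y0 xy subF; have subC : subgraph (~: F) by move=> e; rewrite !inE subgraphV.
have subT : subgraph [set: edge G] by move=> e; rewrite !inE.
rewrite !monomialE //.
rewrite setTI [in RHS](bigID (fun e => e \in F)) /= mulrAC -[LHS]mul1r; congr (_ * _).
  have FE e : (e \in F :&: epos G) = (e \in epos G) && (e \in F) by rewrite inE andbC.
  rewrite [X in _ = _ * X](eq_bigl _ _ FE) -big_split /= big1 // => e _.
  by rewrite xy divff ?gt_eqF.
by apply: eq_bigl => e; rewrite !inE andbC.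
Qed.

(** * From bordered determinants to [psi1] and [psi] *)

Section Weights.
Variables x y : edge G -> K.
Hypotheses (y_gt0 : forall e, 0 < y e) (xV : forall e, x e = (y e)^-1).
Hypothesis G_conn : connected [set: edge G].

Let x_gt0 e : 0 < x e.
Proof. by rewrite xV invr_gt0. Qed.

(** A form of the matrix-tree theorem. For a spanning tree the label matrix is a row of ones, and
    each of the two determinants equals [n]. *)
Lemma det_bordered_psi1 :
  monomial y [set: edge G]
    * \det (block_mx (laplacian_mx x) (const_mx 1) (- const_mx 1) (0 : 'M_1))
  = n%:R ^+ 2 * psi1 y.
Proof.
have n_gt0 : (0 < n)%N by case: G_conn.
rewrite (det_bordered_laplacian _ _ _ (p := fun _ _ => ord0)) => [|F fF cF]; last first.
  have : F \in spanning_trees G by rewrite mem_spanning_trees // fF cF eqxx.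
  rewrite inE => /asboolP[_ [_ con] _]; split=> [i|u v]; last by rewrite eqxx con.
  by have /card_gt0P[v _] := n_gt0; exists v; rewrite (ord1 i).
rewrite /psi1 mulr_sumr [RHS]mulr_sumr; apply: eq_big => [F|F /andP[/asboolP[subF _] _]].
  by rewrite mem_spanning_trees.
rewrite (monomialC y_gt0 xV subF) [RHS]mulrC mulrA; congr (_ * _).
set l := label_mx _ _; have l1 : l = const_mx 1.
  by apply/matrixP => i j; rewrite !mxE (ord1 i).
have d1 : \det ((const_mx 1 : 'rV_n) *m const_mx 1 : 'M[K]_1) = n%:R :> K.
  rewrite det_mx11 mxE (eq_bigr (fun _ => 1)) => [|j _]; last by rewrite !mxE mulr1.
  by rewrite sumr_const card_ord.
by rewrite l1 trmx_const !d1 expr2.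
Qed.

(** The two determinants of each term are conjugate, so they contribute [n ^+ 2] times a squared
    modulus. *)
Lemma det_bordered_psi k (T : {set edge G} -> 'I_k -> {set vertex G})
    (q : 'I_k -> {ffun vertex G -> K^o}) :
  tree_enumeration T -> (forall j, \sum_v (q j v : K) = 0) ->
  let A := row_mx (const_mx 1) (func_mx q) : 'M_(n, 1 + k) in
  monomial y [set: edge G] * \det (block_mx (laplacian_mx x) A (- (map_mx conj A)^T) 0)
    = n%:R ^+ 2 * psi y T q.
Proof.
move=> T_enum sum_q /=.
rewrite (det_bordered_laplacian _ _ _ (p := fun F => tree_label (T F)))
  => [|F fF cF]; last first.
  have [] := T_enum F; first by rewrite mem_forests fF cF eqxx.
  by move=> T_inj T_comp; have [subF _] := asboolP _ fF; apply: tree_labelling.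
rewrite /psi mulr_sumr [RHS]mulr_sumr; apply: eq_big => [F|F /andP[fF /eqP cF]].
  by rewrite mem_forests.
have [] := T_enum F; first by rewrite mem_forests fF cF eqxx.
move=> T_inj T_comp; have [subF _] := asboolP _ fF.
set P := label_mx K _; set A := row_mx _ _.
have -> : (map_mx conj A)^T *m P^T = (map_mx conj (P *m A))^T.
  by rewrite map_mxM map_label_mx trmx_mul.
rewrite det_tr det_map_mx (det_label_tree subF cF T_inj T_comp sum_q).
rewrite rmorphM rmorph_nat /=.
rewrite (monomialC y_gt0 xV subF) conj_norm; ring.
Qed.

Lemma psi_green k (T : {set edge G} -> 'I_k -> {set vertex G})
    (q : 'I_k -> subvs_of (im_dstar conj x)) : tree_enumeration T ->
  psi y T (fun i => vsval (q i)) / psi1 y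
    = \det (\matrix_(i, j) dot0 conj (vsval (q i)) (vsval (green conj x (q j)))).
Proof.
move=> T_enum; have n2 : n%:R ^+ 2 != 0 :> K by rewrite expf_eq0 /= vertices_gt0.
have sum_q j : \sum_v (vsval (q j) v : K) = 0 by apply: im_dstar_sum0 (subvsP _).
have yT : monomial y [set: edge G] != 0.
  by apply/prodf_neq0 => e _; rewrite gt_eqF.
have psi1_neq0 : psi1 y != 0.
  apply: contraTneq (det_bordered_laplacian1_neq0 x_gt0 G_conn) => psi0.
  have /eqP := det_bordered_psi1; rewrite psi0 mulr0 mulf_eq0 (negPf yT) /= => /eqP ->.
  by rewrite eqxx.
apply: (mulIf psi1_neq0); rewrite divfK //; apply: (mulfI n2).
(* Both sides are now the bordered determinant with columns [1] and [q], times the full monomial in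
   [y]. *)
rewrite -(det_bordered_psi T_enum sum_q) det_bordered_laplacian_green //.
by rewrite [LHS]mulrA det_bordered_psi1 -mulrA [psi1 y * _]mulrC.
Qed.

End Weights.

End GreenFunction.

Theorem proposition10p4 (R : realType) (c : scalar_kind) (G : graph)
    (G_connected : connected [set: edge G]) (k : nat) (k_ge1 : (1 <= k)%N)
    (x y : edge G -> scalar_field R c)
    (y_sym : forall e, y (einv e) = y e) (y_gt0 : forall e, 0 < y e)
    (x_inv_y : forall e, x e = (y e)^-1)
    (T : {set edge G} -> 'I_k -> {set vertex G}) (T_enum : tree_enumeration T)
    (q : {ffun 'I_k -> subvs_of (im_dstar (sconj R c) x)}) :
  psi y T (fun i => vsval (q i)) / psi1 y
    = ext_dot (sconj R c) (dot_im (sconj R c) x)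
        (wedge q) (ext_map (green (sconj R c) x) (wedge q))
  /\
  ext_dot (sconj R c) (dot_im (sconj R c) x)
      (wedge q) (ext_map (green (sconj R c) x) (wedge q))
    = \det (\matrix_(i < k, j < k)
        dot0 (sconj R c) (vsval (q i)) (vsval (green (sconj R c) x (q j)))).
Proof.
have conj_norm z : `|z| ^+ 2 = z * sconj R c z.
  case: c z {x y y_sym y_gt0 x_inv_y q} => z /=; last exact: sqr_normc.
  by rewrite real_normK ?num_real // expr2.
(* Both exterior expressions reduce to the Gram determinant; the side goals are that [conj] is an
   involution and that the form is sesquilinear. *)
rewrite ext_map_wedge ext_dot_wedge.
- rewrite (psi_green conj_norm y_gt0 x_inv_y G_connected q T_enum).
  by split; congr (\det _); apply/matrixP => i j; rewrite !mxE ffunE.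
- exact: conj_involutive.
- move=> a u v w; rewrite /dot_im /dot0 mulr_sumr -big_split; apply: eq_bigr => i _ /=.
  by rewrite !ffunE rmorphD rmorphM mulrDl mulrA.
- move=> a u v w; rewrite /dot_im /dot0 mulr_sumr -big_split; apply: eq_bigr => i _ /=.
  by rewrite !ffunE mulrDr mulrCA.
Qed.
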